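(* Let $\mathcal{X}$ be a finite set, $U:\mathcal{X}\to\mathbb{R}$ with $\min_xU(x)=0$, and $Q$ the generator of an ergodic continuous-time Markov chain on $\mathcal{X}$ reversible with respect to its stationary distribution $\pi$. Suppose $c_{M_2}\leq 0$, and let $X^{M_2}$ be the non-homogeneous continuous-time Markov chain with generators $(M_{2,t})_{t\ge0}$ and transition semigroup $(P^{M_2}_{s,t})_{0\le s\le t}$. If the (differentiable) cooling schedule $T(t)$ satisfies $$\int_0^\infty(1+1/T(t))^{-1}\exp\{-c_{M_2}/T(t)\}\,dt=\infty,\qquad( * )$$ $$\lim_{t\to\infty}\Big|\frac{d}{dt}T(t)\Big|\frac{\exp\{c_{M_2}/T(t)\}}{T(t)^2+T(t)^3}=0,\qquad( ** )$$ then $X^{M_2}$ converges in relative entropy: for every $x\in\mathcal{X}$, $$\lim_{t\to\infty}\mathrm{Ent}_{\pi_{T(t)}}\big(P^{M_2}_{0,t}(x,\cdot)\big)=0.$$ Moreover, if $c_{M_2}=0$, then (1) $T(t)=(t+1)^{-\alpha}$ with $\alpha\in(0,1)$ satisfies $( * )$ and $( ** )$. If $c_{M_2}<0$, then, in addition to (1), also (2) $T(t)=e^{-t}$ satisfies $( * )$ and $( ** )$. All of these examples satisfy $\lim_{t\to\infty}T(t)\log(t+1)=0$.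
   Context: $\mathcal{X}$ has at least two points. A cooling schedule is a function $T(t)>0$ that is monotonically decreasing to $0$ as $t\to\infty$. Reversibility: $\pi(x)Q(x,y)=\pi(y)Q(y,x)$ for all $x,y$. For $x\neq y$, $M_{2,t}(x,y)=Q(x,y)\max\{1,e^{(U(x)-U(y))/T(t)}\}=Q(x,y)e^{(U(x)-U(y))_+/T(t)}$ (with $a_+=\max\{a,0\}$), and $M_{2,t}(x,x)=-\sum_{z\neq x}M_{2,t}(x,z)$. $P^{M_2}_{s,t}(x,y)$ is the probability that the chain with these time-dependent generators, started at $x$ at time $s$, is at $y$ at time $t$ (so $\partial_tP_{s,t}=P_{s,t}M_{2,t}$, $P_{s,s}=I$). The Gibbs distribution is $\pi_{T(t)}(x)=e^{-U(x)/T(t)}\pi(x)/Z_{T(t)}$, with $Z_{T(t)}=\sum_xe^{-U(x)/T(t)}\pi(x)$. $\mathrm{Ent}_\nu(\mu)=\sum_x\mu(x)\log(\mu(x)/\nu(x))$. A path from $x$ to $y$ is a sequence $\gamma=(\gamma_i)_{i=0}^n$ with $\gamma_0=x$, $\gamma_n=y$ and $Q(\gamma_{i-1},\gamma_i)>0$ for $i=1,\ldots,n$; $\Gamma^{x,y}$ is the set of such paths. $\mathrm{Elev}_2(\gamma)=\max_{1\le i\le n}\min\{U(\gamma_{i-1}),U(\gamma_i)\}$, $H_2(x,y)=\min_{\gamma\in\Gamma^{x,y}}\mathrm{Elev}_2(\gamma)$, and $c_{M_2}=\max_{x\neq y}\{H_2(x,y)-U(x)-U(y)\}$. *)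

(* Defs.v *)
From HB Require Import structures.
From mathcomp Require Import all_boot all_order all_algebra.
From mathcomp Require Import all_classical all_reals all_analysis.
Set Implicit Arguments.
Unset Strict Implicit.
Unset Printing Implicit Defensive.
Import Order.TTheory GRing.Theory Num.Theory.
Import numFieldNormedType.Exports.
Local Open Scope classical_set_scope.
Local Open Scope ring_scope.

(* Derivative of f at t relative to A: one-sided at an endpoint of A, and the
   usual derivative in the interior of A. *)
Definition is_derive_within (R : realType) (A : set R) (f : R -> R) (t l : R)
    : Prop :=
  (f u - f t) / (u - t) @[u --> within A t^'] --> l.

Section MarkovChain.
Context {R : realType} {X : finType}.
Implicit Types (Q : X -> X -> R) (pi mu nu : X -> R).

Definition is_distribution mu : Prop :=
  (forall x, 0 <= mu x) /\ \sum_x mu x = 1.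

Definition is_generator Q : Prop :=
  (forall x y, x != y -> 0 <= Q x y) /\ (forall x, \sum_y Q x y = 0).

Definition is_stationary Q pi : Prop :=
  is_distribution pi /\ forall y, \sum_x pi x * Q x y = 0.

Definition reversible Q pi : Prop :=
  forall x y, pi x * Q x y = pi y * Q y x.

(* The path (gamma_0, ..., gamma_n) from x to y is represented by its tail
   [:: gamma_1; ...; gamma_n], its head gamma_0 being x. *)
Definition paths Q (x y : X) : set (seq X) :=
  [set p | path (fun a b => 0 < Q a b) x p /\ last x p = y].

(* In continuous time a chain on a finite set is ergodic iff it is irreducible:
   it is then positive recurrent, and there is no periodicity. *)
Definition ergodic Q : Prop := forall x y, paths Q x y !=set0.

(* Kolmogorov's forward equation is d/dt P_{s,t} = P_{s,t} M_t on [s, +oo[ *)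
Definition is_transition_semigroup (M : R -> X -> X -> R)
    (P : R -> R -> X -> X -> R) : Prop :=
  [/\ forall (s t : R) x, 0 <= s -> s <= t -> is_distribution (P s t x),
      forall (s : R) x y, 0 <= s -> P s s x y = (x == y)%:R,
      forall (s u t : R) x y, 0 <= s -> s <= u -> u <= t ->
        P s t x y = \sum_z P s u x z * P u t z y
    & forall (s t : R) x y, 0 <= s -> s <= t ->
        is_derive_within `[s, +oo[ (fun u => P s u x y) t
          (\sum_z P s t x z * M t z y)].

(* Since ln 0 = 0, the convention 0 log 0 = 0 holds. *)
Definition Ent nu mu : R := \sum_x mu x * ln (mu x / nu x).

End MarkovChain.

Section Annealing.
Context {R : realType} {X : finType}.
Variables (Q : X -> X -> R) (U : X -> R).

Definition M2_rate (tau : R) (x y : X) : R :=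
  Q x y * Num.max 1 (expR ((U x - U y) / tau)).

Definition M2 (tau : R) (x y : X) : R :=
  if x == y then - \sum_(z | z != x) M2_rate tau x z else M2_rate tau x y.

Definition gibbs_Z (pi : X -> R) (tau : R) : R :=
  \sum_x expR (- U x / tau) * pi x.

Definition gibbs (pi : X -> R) (tau : R) (x : X) : R :=
  expR (- U x / tau) * pi x / gibbs_Z pi tau.

(* The heights min {U gamma_(i-1), U gamma_i}, for i = 1, ..., n *)
Definition edge_heights (x : X) (p : seq X) : seq R :=
  pairmap (fun a b => Num.min (U a) (U b)) x p.

(* For n >= 1 this is the maximum of the edge heights, as the initial value is
   itself one of them. Only paths between distinct points matter, so n >= 1. *)
Definition Elev2 (x : X) (p : seq X) : R :=
  let s := edge_heights x p in \big[Num.max/head 0 s]_(h <- s) h.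

(* Elev2 takes finitely many values, so this infimum is a minimum as soon as
   there is a path from x to y. *)
Definition H2 (x y : X) : R := inf [set Elev2 x p | p in paths Q x y].

(* The supremum of a finite set, nonempty as soon as X has two points *)
Definition c_M2 : R :=
  sup [set H2 xy.1 xy.2 - U xy.1 - U xy.2 | xy in [set xy : X * X | xy.1 != xy.2]].

End Annealing.

Section Cooling.
Context {R : realType}.
Implicit Types (T : R -> R) (c : R).

(* Schedules are functions on [0, +oo[: their values at negative times are
   irrelevant. *)
Definition cooling_schedule T : Prop :=
  [/\ forall t : R, 0 <= t -> 0 < T t,
      forall s t : R, 0 <= s -> s <= t -> T t <= T s
    & T t @[t --> +oo] --> (0 : R)].

Definition differentiable_schedule T : Prop :=
  forall t : R, 0 <= t -> exists l, is_derive_within `[0, +oo[ T t l.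

Definition integral_condition c T : Prop :=
  (\int[lebesgue_measure]_(t in `[0%R, +oo[)
     ((1 + 1 / T t)^-1 * expR (- c / T t))%:E = +oo)%E.

Definition derivative_condition c T : Prop :=
  `|derive1 T t| * (expR (c / T t) / (T t ^+ 2 + T t ^+ 3))
    @[t --> +oo] --> (0 : R).

Definition power_schedule (alpha t : R) : R := (t + 1) `^ (- alpha).

Definition exp_schedule (t : R) : R := expR (- t).

(* A differentiable schedule with both conditions of the convergence theorem *)
Definition admissible c T : Prop :=
  [/\ cooling_schedule T, differentiable_schedule T,
      integral_condition c T & derivative_condition c T].

End Cooling.

(* Main.v *)
Require Import Defs.
From HB Require Import structures.
From mathcomp Require Import all_boot all_order all_algebra.
From mathcomp Require Import all_classical all_reals all_analysis.
From mathcomp Require Import measurable_realfun ring lra.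
Import Order.TTheory GRing.Theory Num.Theory.
Import numFieldNormedType.Exports.
Local Open Scope classical_set_scope.
Local Open Scope ring_scope.

Set Implicit Arguments.
Unset Strict Implicit.
Unset Printing Implicit Defensive.

(** The convergence is first proved for the chi-square divergence
    G(t) = sum_x mu_t(x)^2 / nu_t(x) - 1 of mu_t = P_{0,t}(x, .) from the Gibbs
    distribution nu_t at temperature T(t). The relative entropy lies between 0
    and G(t), because 1 - 1/r <= ln r <= r - 1 (Ent_ge0, Ent_le). Unlike the
    entropy, G is a polynomial in mu_t, so it can be differentiated even at
    times when mu_t vanishes at some points.

    The derivative of G has two parts. The motion of mu_t contributes minus the
    Dirichlet form of mu_t / nu_t. The generator M_2 is reversible for the Gibbs
    distribution, and its conductance along an edge {a, b} is proportional to
    pi(a) Q(a,b) exp(- min(U(a), U(b)) / T) (gibbs_M2). Joining each pair of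
    points by a path of least elevation, and bounding the squared increment of a
    function between its end points by the squared increments along the edges,
    gives a spectral gap of order lambda = k exp(- c / T), where c is c_M2
    (M2_spectral_gap). The exponent c appears because exp(- (U(x) + U(y)) / T)
    is at most exp(c / T) exp(- H_2(x,y) / T).

    The motion of nu_t contributes at most U_max (|T'| / T^2) (G + 1)
    (second_moment_derive), and the condition on the derivative of T says that
    this is o(lambda) (G + 1) (small_drift). So, for every e > 0, eventually
    G' <= - lambda (G - e). Since c <= 0, lambda is bounded below by the constant
    k > 0, and a comparison with exp(- k t) shows that G tends to 0
    (forced_decay).

    For the explicit schedules, divergence of the integral follows from lower
    bounds of the integrand on the intervals [0, s] (integral_condition_lb), and
    the limits from the decay of negative powers and exponentials. *)

(** * Paths and heights *)
Section Paths.
Context {R : realType} {X : finType}.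
Implicit Types (Q : X -> X -> R) (U f pi : X -> R).

(** Reversibility propagates positivity along the edges: if Q a b > 0 and
    pi a > 0, then pi b * Q b a > 0. *)
Lemma reversible_gt0 Q pi : ergodic Q -> is_distribution pi ->
  reversible Q pi -> forall x, 0 < pi x.
Proof.
move=> Q_erg [pi_ge0 pi_sum] Q_rev.
have [a pia] : exists a, 0 < pi a.
  apply/not_existsP => pi_le0.
  have : \sum_x pi x = 0.
    apply: big1 => x _; apply/eqP; rewrite eq_le pi_ge0 andbT leNgt.
    exact/negP.
  by rewrite pi_sum => /eqP; rewrite oner_eq0.
move=> x; have [p [+ <-]] := Q_erg a x.
elim: p a pia => //= b p IHp a pia /andP[Qab path_p].
apply: IHp path_p; rewrite lt_def pi_ge0 andbT.
apply/eqP => pib0; have := Q_rev a b; rewrite pib0 mul0r => /eqP.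
by rewrite mulf_eq0 !gt_eqF.
Qed.

Lemma Elev2_ge U x p : all (<= Elev2 U x p) (edge_heights U x p).
Proof.
rewrite /Elev2; move: (edge_heights U x p) (head 0 _) => s h0.
apply/allP => h /=; elim: s => // k s IHs; rewrite inE big_cons le_max.
by case/predU1P => [->|/IHs ->]; rewrite ?lexx ?orbT.
Qed.

Lemma edge_heights_sub U x p h : h \in edge_heights U x p ->
  exists ab : X * X, h = Num.min (U ab.1) (U ab.2).
Proof.
elim: p x => //= b p IHp x; rewrite inE => /predU1P[->|/IHp//].
by exists (x, b).
Qed.

Lemma Elev2_edge U x p : p != [::] ->
  exists ab : X * X, Elev2 U x p = Num.min (U ab.1) (U ab.2).
Proof.
case: p => //= b p _; rewrite /Elev2.
have sP h : h \in edge_heights U x (b :: p) ->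
    exists ab : X * X, h = Num.min (U ab.1) (U ab.2).
  exact: edge_heights_sub.
rewrite big_seq; apply: (@big_ind _ (fun h =>
  exists ab : X * X, h = Num.min (U ab.1) (U ab.2))) => [|h k Hh Hk|h hs];
  last exact: sP.
- by exists (x, b).
- by rewrite /Num.max; case: ifP.
Qed.

Lemma path_neq_nil Q x y p : x != y -> paths Q x y p -> p != [::].
Proof. by move=> xy [_ lp]; apply: contraNneq xy => p0; rewrite -lp p0. Qed.

(** The elevation of a path between distinct points is one of the finitely many
    numbers min (U a) (U b), so an infimum of elevations is a minimum. *)
Lemma H2_attained Q U x y : ergodic Q -> x != y ->
  exists2 p, paths Q x y p & Elev2 U x p = H2 Q U x y.
Proof.
move=> Q_erg xy.
pose att (ab : X * X) := `[< exists2 p, paths Q x y p &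
  Elev2 U x p = Num.min (U ab.1) (U ab.2) >].
have attP p : paths Q x y p -> exists2 ab, att ab &
    Elev2 U x p = Num.min (U ab.1) (U ab.2).
  move=> xyp; have [ab pab] := Elev2_edge U x (path_neq_nil xy xyp).
  by exists ab => //; apply/asboolP; exists p.
have [p0 /attP[ab0 att0 _]] := Q_erg x y.
case: (arg_minP (fun ab : X * X => Num.min (U ab.1) (U ab.2)) att0).
move=> ab /asboolP[p xyp pab] abmin; exists p => //.
apply/eqP; rewrite eq_le; apply/andP; split.
  apply: lb_le_inf; first by exists (Elev2 U x p); exists p.
  by move=> _ [q /attP[cd attcd ->] <-]; rewrite pab; exact: abmin.
apply: ge_inf; last by exists p.
exists (Elev2 U x p) => _ [q /attP[cd attcd ->] <-].
by rewrite pab; exact: abmin.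
Qed.

Lemma H2_le_c_M2 Q U x y : ergodic Q -> x != y ->
  H2 Q U x y <= c_M2 Q U + U x + U y.
Proof.
move=> Q_erg xy; rewrite -lerBlDr -lerBlDr addrAC.
apply: ub_le_sup; last by exists (x, y) => //=; rewrite addrAC.
have U_le z : U z <= \sum_t `|U t|.
  by rewrite (bigD1 z)//= (le_trans (ler_norm _))// lerDl sumr_ge0.
have U_geN z : - U z <= \sum_t `|U t|.
  by rewrite (bigD1 z)//= -normrN (le_trans (ler_norm _))// lerDl sumr_ge0.
(* The supremum is over a set bounded above by three times sum |U|: one for
   H2, which is a value of U, and one for each of - U a and - U b. *)
exists (\sum_t `|U t| + \sum_t `|U t| + \sum_t `|U t|).
move=> _ [[a b] ab <-]/=; apply: lerD => //; apply: lerD => //.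
have [p abp <-] := H2_attained U Q_erg ab.
have [[u v] ->] := Elev2_edge U a (path_neq_nil ab abp).
by rewrite /= ge_min U_le.
Qed.

(** Up to the factor 1 / Z, this is the conductance gibbs a * M2 a b. *)
Definition edge_weight Q U pi (tau : R) (a b : X) : R :=
  pi a * Q a b * expR (- Num.min (U a) (U b) / tau).

(** Up to the factor 1 / (2 Z), this is the Dirichlet form of M2. *)
Definition edge_energy Q U pi (tau : R) f : R :=
  \sum_a \sum_(b | b != a) edge_weight Q U pi tau a b * (f a - f b) ^+ 2.

Lemma edge_weight_ge0 Q U pi tau a b : is_generator Q -> (forall x, 0 < pi x) ->
  b != a -> 0 <= edge_weight Q U pi tau a b.
Proof.
move=> [Q_ge0 _] pi_gt0 ba; rewrite mulr_ge0 ?expR_ge0// mulr_ge0 ?(ltW (pi_gt0 _))//.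
by rewrite Q_ge0// eq_sym.
Qed.

Lemma edge_energy_term Q U pi tau f a b :
  is_generator Q -> (forall x, 0 < pi x) -> b != a ->
  edge_weight Q U pi tau a b * (f a - f b) ^+ 2 <= edge_energy Q U pi tau f.
Proof.
move=> Q_gen pi_gt0 ba; rewrite /edge_energy (bigD1 a)//= (bigD1 b)//= -addrA.
rewrite lerDl addr_ge0 ?sumr_ge0//.
  by move=> c /andP[? _]; rewrite mulr_ge0 ?sqr_ge0 ?edge_weight_ge0.
move=> c _; rewrite sumr_ge0// => d dc.
by rewrite mulr_ge0 ?sqr_ge0 ?edge_weight_ge0.
Qed.

Lemma edge_energy_ge0 Q U pi tau f : is_generator Q -> (forall x, 0 < pi x) ->
  0 <= edge_energy Q U pi tau f.
Proof.
move=> Q_gen pi_gt0; rewrite sumr_ge0// => c _; rewrite sumr_ge0// => d dc.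
by rewrite mulr_ge0 ?sqr_ge0 ?edge_weight_ge0.
Qed.

(** Each edge of the path has height at most h, so its weight is at least
    pi a * Q a b * expR (- h / tau), and the increment along the path is split
    by (u + v)^2 <= 2 u^2 + 2 v^2 at each step. The constant grows exponentially
    with the length of the path, but it depends on neither f nor tau. *)
Lemma path_comparison Q U pi x p : is_generator Q -> (forall x, 0 < pi x) ->
  path (fun a b => 0 < Q a b) x p ->
  exists2 C, 0 <= C & forall (f : X -> R) (tau h : R), 0 < tau ->
    all (<= h) (edge_heights U x p) ->
    expR (- h / tau) * (f x - f (last x p)) ^+ 2 <= C * edge_energy Q U pi tau f.
Proof.
move=> Q_gen pi_gt0.
elim: p x => [x _|b p IHp x /= /andP[Qxb /IHp[C C0 HC]]].
  exists 0 => // f tau h _ _ /=.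
  by rewrite subrr expr0n mulr0 mul0r.
have piQ : 0 < pi x * Q x b by rewrite mulr_gt0.
exists (2 * (pi x * Q x b)^-1 + 2 * C).
  by rewrite addr_ge0// mulr_ge0// invr_ge0 ltW.
move=> f tau h tau0 /andP[hxb hp].
have {}HC := HC f tau h tau0 hp.
have edge : expR (- h / tau) * (f x - f b) ^+ 2 <=
    (pi x * Q x b)^-1 * edge_energy Q U pi tau f.
  have [bx|bx] := eqVneq b x.
    have -> : f x - f b = 0 by rewrite bx subrr.
    rewrite expr0n mulr0; apply: mulr_ge0; first by rewrite invr_ge0 ltW.
    exact: edge_energy_ge0.
  rewrite ler_pdivlMl// mulrA.
  apply: le_trans (edge_energy_term U tau f Q_gen pi_gt0 bx).
  rewrite ler_wpM2r ?sqr_ge0// ler_wpM2l ?(ltW piQ)//.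
  by rewrite ler_expR ler_wpM2r ?invr_ge0 ?(ltW tau0)// lerN2.
have split2 : (f x - f (last b p)) ^+ 2 <=
    2 * (f x - f b) ^+ 2 + 2 * (f b - f (last b p)) ^+ 2.
    have := sqr_ge0 (f x - 2 * f b + f (last b p)); nra.
apply: le_trans (ler_wpM2l (expR_ge0 _) split2) _.
rewrite mulrDr mulrDl [in leRHS]mulrDl; lra.
Qed.

(** A path of least elevation is used: its elevation H2 Q U x y is at most
    c_M2 Q U + U x + U y. *)
Lemma pair_comparison Q U pi x y : is_generator Q -> ergodic Q ->
  (forall x, 0 < pi x) ->
  exists2 C, 0 <= C & forall (f : X -> R) (tau : R), 0 < tau ->
    expR (- (U x + U y) / tau) * (f x - f y) ^+ 2 <=
    C * (expR (c_M2 Q U / tau) * edge_energy Q U pi tau f).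
Proof.
move=> Q_gen Q_erg pi_gt0; have [->|xy] := eqVneq x y.
  by exists 0 => // f tau _; rewrite subrr expr0n mulr0 mul0r.
have [p [pathp lastp] H2p] := H2_attained U Q_erg xy.
have [C C0 HC] := path_comparison U Q_gen pi_gt0 pathp.
exists C => // f tau tau0; have := HC f tau _ tau0 (Elev2_ge U x p).
rewrite lastp => {}HC.
rewrite [leRHS]mulrCA; apply: le_trans (ler_wpM2l (expR_ge0 _) HC).
rewrite [leRHS]mulrA -expRD -mulrDl ler_wpM2r ?sqr_ge0// ler_expR.
rewrite ler_wpM2r ?invr_ge0 ?(ltW tau0)//.
have := H2_le_c_M2 U Q_erg xy; rewrite H2p; lra.
Qed.

Lemma all_pairs_comparison Q U pi : is_generator Q -> ergodic Q ->
  (forall x, 0 < pi x) ->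
  exists2 C, 0 <= C & forall (f : X -> R) (tau : R), 0 < tau ->
    \sum_x \sum_y pi x * pi y *
       (expR (- (U x + U y) / tau) * (f x - f y) ^+ 2) <=
    C * (expR (c_M2 Q U / tau) * edge_energy Q U pi tau f).
Proof.
move=> Q_gen Q_erg pi_gt0.
have /choice[C HC] : forall xy : X * X, exists C, 0 <= C /\
    forall (f : X -> R) (tau : R), 0 < tau ->
    expR (- (U xy.1 + U xy.2) / tau) * (f xy.1 - f xy.2) ^+ 2 <=
    C * (expR (c_M2 Q U / tau) * edge_energy Q U pi tau f).
  move=> [x y]; have [C C0 HC] := pair_comparison U x y Q_gen Q_erg pi_gt0.
  by exists C; split.
exists (\sum_x \sum_y pi x * pi y * C (x, y)).
  apply: sumr_ge0 => x _; apply: sumr_ge0 => y _.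
  by rewrite !mulr_ge0 ?(ltW (pi_gt0 _))//; have [] := HC (x, y).
move=> f tau tau0; rewrite mulr_suml; apply: ler_sum => x _.
rewrite mulr_suml; apply: ler_sum => y _.
rewrite -[leRHS]mulrA ler_wpM2l//; first by rewrite !mulr_ge0 ?(ltW (pi_gt0 _)).
by have [_ /(_ f tau tau0)] := HC (x, y).
Qed.

End Paths.

(** * Chi-square divergence and Dirichlet form *)
Section ChiSquare.
Context {R : realType} {X : finType}.
Implicit Types (Q W : X -> X -> R) (U f pi mu nu : X -> R) (tau : R).

(** Equal to 1 plus the chi-square divergence of mu from nu, when both have
    total mass 1. *)
Definition second_moment nu mu : R := \sum_x mu x ^+ 2 / nu x.

(** Gibbs' inequality, from ln (1 / r) <= 1 / r - 1. Where mu vanishes the term is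
    0 >= - nu x. *)
Lemma Ent_ge0 nu mu : (forall x, 0 < nu x) -> \sum_x nu x = 1 ->
  is_distribution mu -> 0 <= Ent nu mu.
Proof.
move=> nu_gt0 nu1 [mu_ge0 mu1].
suff : \sum_x (mu x - nu x) <= Ent nu mu.
  by rewrite big_split/= sumrN mu1 nu1 subrr.
apply: ler_sum => x _; have := mu_ge0 x; rewrite le_eqVlt => /predU1P[<-|mux].
  by rewrite mul0r sub0r oppr_le0 ltW.
have r0 : 0 < nu x / mu x by rewrite divr_gt0.
have -> : mu x / nu x = (nu x / mu x)^-1 by rewrite invf_div.
have := @le_ln1Dx R (nu x / mu x - 1).
rewrite ltrBrDl subrr addrC subrK => /(_ r0) lnle.
have -> : mu x - nu x = mu x * (1 - nu x / mu x) by field; rewrite gt_eqF.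
rewrite lnV ?posrE//; apply: ler_wpM2l; first exact: ltW.
by rewrite lerNr opprB.
Qed.

(** From ln r <= r - 1, applied to r = mu x / nu x. *)
Lemma Ent_le nu mu : (forall x, 0 < nu x) ->
  is_distribution mu -> Ent nu mu <= second_moment nu mu - 1.
Proof.
move=> nu_gt0 [mu_ge0 <-]; rewrite /second_moment -sumrB.
apply: ler_sum => x _; have := mu_ge0 x; rewrite le_eqVlt => /predU1P[<-|mux].
  by rewrite expr0n !mul0r subrr.
have r0 : 0 < mu x / nu x by rewrite divr_gt0.
have -> : mu x ^+ 2 / nu x - mu x = mu x * (mu x / nu x - 1).
  by rewrite mulrBr mulr1 mulrA.
apply: ler_wpM2l; first exact: ltW.
have := @le_ln1Dx R (mu x / nu x - 1).
by rewrite ltrBrDl subrr [1 + _]addrC subrK => /(_ r0).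
Qed.

(** The variance of mu / nu under nu, as a double sum over pairs of points. *)
Lemma variance_pairs nu mu : (forall x, 0 < nu x) -> \sum_x nu x = 1 ->
  \sum_x mu x = 1 ->
  \sum_x \sum_y nu x * nu y * (mu x / nu x - mu y / nu y) ^+ 2 =
  2 * (second_moment nu mu - 1).
Proof.
move=> nu_gt0 nu1 mu1.
have -> : second_moment nu mu - 1 = (\sum_x mu x ^+ 2 / nu x) * (\sum_y nu y) -
    (\sum_x mu x) * (\sum_y mu y) by rewrite nu1 mu1 !mulr1.
have -> : 2 * ((\sum_x mu x ^+ 2 / nu x) * (\sum_y nu y) -
    (\sum_x mu x) * (\sum_y mu y)) =
  (\sum_x mu x ^+ 2 / nu x) * (\sum_y nu y) +
  (\sum_x nu x) * (\sum_y mu y ^+ 2 / nu y) - 2 * ((\sum_x mu x) * (\sum_y mu y)).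
  ring.
rewrite !big_distrlr/= [X in _ - X]mulr_sumr -big_split -sumrB/=.
apply: eq_bigr => x _; rewrite mulr_sumr -big_split -sumrB/=.
apply: eq_bigr => y _; have := nu_gt0 x; have := nu_gt0 y => /gt_eqF ? /gt_eqF ?.
by field; apply/andP; split; apply/negbT.
Qed.

(** Expanding the square, the two terms in f x ^+ 2 and f y ^+ 2 vanish since the
    rows and, by symmetry, the columns of W have sum 0. *)
Lemma dirichlet_identity W f : (forall x y, W x y = W y x) ->
  (forall x, \sum_y W x y = 0) ->
  \sum_y (\sum_z f z * W z y) * f y =
  - 2^-1 * \sum_x \sum_(y | y != x) W x y * (f x - f y) ^+ 2.
Proof.
move=> W_sym W_sum.
have -> : \sum_x \sum_(y | y != x) W x y * (f x - f y) ^+ 2 =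
   \sum_x \sum_y W x y * (f x - f y) ^+ 2.
  by apply: eq_bigr => x _; rewrite [RHS](bigD1 x)//= subrr expr0n mulr0 add0r.
have sq1 : \sum_x \sum_y W x y * f x ^+ 2 = 0.
  by apply: big1 => x _; rewrite -mulr_suml W_sum mul0r.
have sq2 : \sum_x \sum_y W x y * f y ^+ 2 = 0.
  rewrite exchange_big/= -[RHS]sq1; apply: eq_bigr => x _; apply: eq_bigr => y _.
  by rewrite W_sym.
transitivity (- 2^-1 * (\sum_x \sum_y W x y * f x ^+ 2 +
  \sum_x \sum_y W x y * f y ^+ 2 - 2 * \sum_x \sum_y W x y * (f x * f y))).
  rewrite sq1 sq2 add0r sub0r mulrNN mulrA mulVf ?pnatr_eq0// mul1r exchange_big/=.
  apply: eq_bigr => y _; rewrite mulr_suml; apply: eq_bigr => z _.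
  by rewrite mulrA [f z * _]mulrC.
congr (_ * _); rewrite mulr_sumr -big_split -sumrB/=; apply: eq_bigr => x _.
rewrite mulr_sumr -big_split -sumrB/=; apply: eq_bigr => y _.
ring.
Qed.

Lemma gibbs_Z_ge U pi tau x0 : (forall x, 0 < pi x) -> U x0 = 0 ->
  pi x0 <= gibbs_Z U pi tau.
Proof.
move=> pi_gt0 Ux0; rewrite /gibbs_Z (bigD1 x0)//= Ux0 oppr0 mul0r expR0 mul1r.
by rewrite lerDl sumr_ge0// => x _; rewrite mulr_ge0 ?expR_ge0// ltW.
Qed.

Lemma gibbs_Z_gt0 U pi tau : (forall x, 0 < pi x) -> \sum_x pi x = 1 ->
  0 < gibbs_Z U pi tau.
Proof.
move=> pi_gt0 pi1.
have Z_ge0 x : 0 <= expR (- U x / tau) * pi x.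
  by rewrite mulr_ge0 ?expR_ge0// ltW.
rewrite lt_def sumr_ge0 ?andbT//.
apply/eqP => /(psumr_eq0P (fun x _ => Z_ge0 x)) Z0.
have /eqP := pi1; rewrite big1 ?(eq_sym 0) ?oner_eq0// => x _.
by have /eqP := Z0 x isT; rewrite mulf_eq0 gt_eqF ?expR_gt0//= => /eqP.
Qed.

Lemma gibbs_gt0 U pi tau x : (forall x, 0 < pi x) -> \sum_x pi x = 1 ->
  0 < gibbs U pi tau x.
Proof.
move=> pi_gt0 pi1.
by rewrite divr_gt0 ?gibbs_Z_gt0// mulr_gt0 ?expR_gt0.
Qed.

Lemma gibbs_sum U pi tau : (forall x, 0 < pi x) -> \sum_x pi x = 1 ->
  \sum_x gibbs U pi tau x = 1.
Proof.
move=> pi_gt0 pi1; rewrite -mulr_suml divff// gt_eqF//; exact: gibbs_Z_gt0.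
Qed.

Lemma M2_row_sum Q U tau x : \sum_y M2 Q U tau x y = 0.
Proof.
rewrite (bigD1 x)//= {1}/M2 eqxx addrC; apply/eqP; rewrite subr_eq0; apply/eqP.
by apply: eq_bigr => y yx; rewrite /M2 eq_sym (negbTE yx).
Qed.

(** Multiplying expR (- U x / tau) by the acceleration factor of M2 lowers the
    height of the edge to the smaller of the two end points. *)
Lemma gibbs_M2 Q U pi tau x y : 0 < tau -> y != x ->
  gibbs U pi tau x * M2 Q U tau x y =
  (gibbs_Z U pi tau)^-1 * edge_weight Q U pi tau x y.
Proof.
move=> tau0 yx; rewrite /M2 eq_sym (negbTE yx) /M2_rate /edge_weight /gibbs.
have -> : expR (- Num.min (U x) (U y) / tau) =
    expR (- U x / tau) * Num.max 1 (expR ((U x - U y) / tau)).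
  have [Uxy|/ltW Uyx] := leP (U x) (U y).
    rewrite max_l ?mulr1// -expR0 ler_expR pmulr_lle0 ?invr_gt0//.
    by rewrite subr_le0.
  rewrite max_r; last by rewrite -expR0 ler_expR mulr_ge0 ?subr_ge0// invr_ge0 ltW.
  by rewrite -expRD -mulrDl; congr (expR (_ / _)); ring.
ring.
Qed.

Lemma gibbs_M2_sym Q U pi tau x y : reversible Q pi -> 0 < tau ->
  gibbs U pi tau x * M2 Q U tau x y = gibbs U pi tau y * M2 Q U tau y x.
Proof.
move=> Q_rev tau0; have [->//|yx] := eqVneq y x.
rewrite gibbs_M2// gibbs_M2 1?eq_sym// /edge_weight.
by rewrite (Q_rev x y) minC.
Qed.

Lemma M2_dissipation Q U pi tau mu : (forall x, 0 < pi x) ->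
  \sum_x pi x = 1 -> reversible Q pi -> 0 < tau ->
  \sum_y (\sum_z mu z * M2 Q U tau z y) * (mu y / gibbs U pi tau y) =
  - 2^-1 * ((gibbs_Z U pi tau)^-1 *
     edge_energy Q U pi tau (fun x => mu x / gibbs U pi tau x)).
Proof.
move=> pi_gt0 pi1 Q_rev tau0.
have g0 x : gibbs U pi tau x != 0 by rewrite gt_eqF ?gibbs_gt0.
pose W x y := gibbs U pi tau x * M2 Q U tau x y.
have W_sum x : \sum_y W x y = 0 by rewrite -mulr_sumr M2_row_sum mulr0.
have := dirichlet_identity (fun x => mu x / gibbs U pi tau x)
  (fun x y => gibbs_M2_sym U x y Q_rev tau0) W_sum.
rewrite /edge_energy => dir.
transitivity (\sum_y (\sum_z mu z / gibbs U pi tau z * W z y) *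
    (mu y / gibbs U pi tau y)).
  apply: eq_bigr => y _; congr (_ * _); apply: eq_bigr => z _.
  by rewrite /W mulrA divfK.
rewrite dir; congr (_ * _); rewrite mulr_sumr; apply: eq_bigr => x _.
rewrite mulr_sumr; apply: eq_bigr => y yx.
by rewrite gibbs_M2// [RHS]mulrA.
Qed.

(** The variance of mu / gibbs is at most a constant times
    expR (c_M2 Q U / tau) times the edge energy, hence so is the chi-square
    divergence. The normalisations leave a factor gibbs_Z, which is bounded below
    uniformly in tau by the mass of a minimiser of U. *)
Lemma M2_spectral_gap Q U pi : is_generator Q -> ergodic Q ->
  (forall x, 0 < pi x) -> \sum_x pi x = 1 -> reversible Q pi ->
  (exists x, U x = 0) ->
  exists2 k, 0 < k & forall mu tau, 0 < tau -> \sum_x mu x = 1 ->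
    \sum_y (\sum_z mu z * M2 Q U tau z y) * (mu y / gibbs U pi tau y) <=
    - (k * expR (- c_M2 Q U / tau)) * (second_moment (gibbs U pi tau) mu - 1).
Proof.
move=> Q_gen Q_erg pi_gt0 pi1 Q_rev [x0 Ux0].
have [C C0 HC] := all_pairs_comparison U Q_gen Q_erg pi_gt0.
(* C may be 0, so C + 1 is used as a divisor. *)
exists (pi x0 / (C + 1)); first by rewrite divr_gt0// ltr_wpDl.
move=> mu tau tau0 mu1; rewrite M2_dissipation//.
set g := gibbs U pi tau; set Z := gibbs_Z U pi tau.
have Z0 : 0 < Z by exact: gibbs_Z_gt0.
have Zx0 : pi x0 <= Z by exact: gibbs_Z_ge.
have := variance_pairs (fun x => gibbs_gt0 U tau x pi_gt0 pi1)
  (gibbs_sum U tau pi_gt0 pi1) mu1.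
rewrite -/g; set E := edge_energy _ _ _ _ _; set G := _ - 1 => var.
have {}HC : 2 * G <= Z ^- 2 * ((C + 1) * (expR (c_M2 Q U / tau) * E)).
  rewrite -var; apply: (@le_trans _ _ (Z ^- 2 *
     (C * (expR (c_M2 Q U / tau) * E)))); last first.
    rewrite ler_wpM2l ?invr_ge0 ?sqr_ge0//.
    by rewrite ler_wpM2r ?lerDl// mulr_ge0 ?expR_ge0//; exact: edge_energy_ge0.
  apply: le_trans (ler_wpM2l _ (HC _ tau tau0)); last first.
    by rewrite invr_ge0 sqr_ge0.
  rewrite le_eqVlt; apply/orP; left; apply/eqP.
  rewrite mulr_sumr; apply: eq_bigr => x _; rewrite mulr_sumr; apply: eq_bigr => y _.
  rewrite opprD mulrDl expRD /g /gibbs -/Z; have := gt_eqF Z0 => Zn.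
  set fx := (_ - _).
  by field; rewrite Zn.
have G0 : 0 <= G.
  have : 0 <= 2 * G.
    rewrite -var; apply: sumr_ge0 => x _; apply: sumr_ge0 => y _.
    by rewrite mulr_ge0 ?sqr_ge0// mulr_ge0// ltW// gibbs_gt0.
  by rewrite pmulr_rge0.
rewrite [leLHS]mulNr [leRHS]mulNr lerN2.
have expc : expR (- c_M2 Q U / tau) = (expR (c_M2 Q U / tau))^-1.
  by rewrite mulNr expRN.
have e0 : 0 < expR (c_M2 Q U / tau) by exact: expR_gt0.
have C1 : 0 < C + 1 by rewrite ltr_wpDl.
apply: (@le_trans _ _ (Z / (C + 1) * expR (- c_M2 Q U / tau) * G)).
  apply: ler_wpM2r => //. apply: ler_wpM2r; first exact: expR_ge0.
  by apply: ler_wpM2r => //; rewrite invr_ge0 ltW.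
rewrite expc; move: HC e0; move: (expR _) => e HC e0.
have -> : Z / (C + 1) / e * G = 2^-1 * (Z / (C + 1) / e * (2 * G)).
  by field; rewrite !gt_eqF.
rewrite ler_wpM2l ?invr_ge0//.
have w0 : 0 <= Z / (C + 1) / e by rewrite !mulr_ge0 ?invr_ge0 ?ltW.
apply: le_trans (ler_wpM2l w0 HC) _.
rewrite le_eqVlt; apply/orP; left; apply/eqP.
by field; rewrite !gt_eqF.
Qed.

End ChiSquare.

(** * Differential inequalities *)
Section Calculus.
Context {R : realType}.
Implicit Types (f g T : R -> R) (t l : R).

(** Caratheodory's form of differentiability only involves continuity of the
    slope, for which the restriction to a neighbourhood of t is harmless. *)
Lemma is_derive_withinE (A : set R) f t l : nbhs t A ->
  is_derive_within A f t l -> is_derive t (1 : R) f l.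
Proof.
move=> At fl; apply/is_derive1_caratheodory.
exists (fun u => if u == t then l else (f u - f t) / (u - t)).
split; last by rewrite eqxx.
- move=> z; case: eqVneq => [->|zt]; first by rewrite !subrr mulr0.
  by rewrite divfK// subr_eq0.
- apply/continuous_withinNx; rewrite eqxx => P /fl HP.
  have HA : \forall u \near t^', A u by exact: nbhs_dnbhs.
  apply: filterS3 HA (nbhs_dnbhs_neq t) HP => u Au ut /(_ Au).
  by rewrite /= (negbTE ut).
Qed.

Lemma is_derive_within_weaken (A : set R) f t l :
  is_derive t (1 : R) f l -> is_derive_within A f t l.
Proof.
move=> /is_derive1_caratheodory[g [fg /continuous_withinNx gc gl]].
have H : (f u - f t) / (u - t) @[u --> t^'] --> l.
  rewrite -gl; apply: cvg_trans gc; apply: near_eq_cvg; near=> u.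
  have ut : u != t by near: u; exact: nbhs_dnbhs_neq.
  by rewrite fg mulfK// subr_eq0.
by apply: cvg_trans H; apply: cvg_app; exact: cvg_within.
Unshelve. all: by end_near. Qed.

Lemma is_derive_nonincreasing_le0 f t l : is_derive t (1 : R) f l ->
  (forall s, t <= s -> f s <= f t) -> l <= 0.
Proof.
move=> /is_derive1_caratheodory[g [fg gc gl]] fdec.
rewrite leNgt; apply/negP => l0.
have : \forall u \near t, 0 < g u by apply: (cvgr_gt _ gc); rewrite gl.
move=> /nbhs_ballP[e /= e0 He].
have : 0 < g (t + e / 2).
  by apply: He; rewrite /ball/= opprD addrA subrr sub0r normrN gtr0_norm; lra.
have := fg (t + e / 2); have := fdec (t + e / 2) ltac:(lra).
rewrite (addrC t) addrK; nra.
Qed.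

(** A maximum principle. If f b exceeded the bound, the function
    f t - eta (t - a) would, for a small eta > 0, have its maximum over [a, b] at
    some c > a where f c > 0; but its derivative at c would be at most - eta, so
    it would be larger just before c. *)
Lemma le_max_of_derive_le0 f df (a b : R) : a <= b ->
  (forall t, a <= t -> t <= b -> is_derive t (1 : R) f (df t)) ->
  (forall t, a <= t -> t <= b -> 0 < f t -> df t <= 0) ->
  f b <= Num.max (f a) 0.
Proof.
move=> ab fdf df0; rewrite leNgt; apply/negP; set m := Num.max _ _ => mfb.
have m0 : 0 <= m by rewrite le_max lexx orbT.
have fam : f a <= m by rewrite le_max lexx.
(* With this slope, f t - eta (t - a) is still above m at b. *)
pose eta := (f b - m) / (2 * (b - a + 1)).
have d0 : 0 < b - a + 1 by lra.
have eta0 : 0 < eta by rewrite divr_gt0; lra.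
have etaE : eta * (2 * (b - a + 1)) = f b - m by rewrite divfK// gt_eqF; lra.
pose g t := f t - eta * (t - a).
have gcont : {within `[a, b], continuous g}.
  apply: derivable_within_continuous => t; rewrite in_itv/= => /andP[ta tb].
  apply: derivableB; first by have := fdf t ta tb; case.
  by apply: derivableM => //; apply: derivableB.
have [c /itvP cab cmax] := EVT_max ab gcont.
have /cmax : b \in `[a, b] by rewrite in_itv/= ab lexx.
have acb : a <= c <= b by rewrite !cab.
move: acb cmax => {cab} /andP[ac cb] cmax; rewrite /g => gbc.
have fc : m < f c by nra.
have {ac}ac : a < c.
  by rewrite lt_neqAle ac andbT; apply: contraTneq fc => <-; rewrite -leNgt.
have /is_derive1_caratheodory[h [fh hc hdf]] := fdf c (ltW ac) cb.
(* h is the slope of f from c: below eta near c, it contradicts maximality. *)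
have : h c < eta by rewrite hdf; have := df0 c (ltW ac) cb; lra.
move=> /(cvgr_lt _ hc)/nbhs_ballP[e /= e0 He].
pose z := c - Num.min (e / 2) ((c - a) / 2).
have [za zc] : a < z /\ z < c.
  rewrite /z; have [] := leP (e / 2) ((c - a) / 2); split; lra.
have zb : ball c e z.
  rewrite /ball/= /z opprB addrCA subrr addr0 gtr0_norm.
    by rewrite gt_min; apply/orP; left; lra.
  by rewrite lt_min; apply/andP; split; lra.
have := He z zb; have := fh z.
have : z \in `[a, b] by rewrite in_itv/=; apply/andP; split; lra.
move=> /cmax; rewrite /g; nra.
Qed.

(** While f exceeds e, expR (k * t) * (f t - e) has a nonpositive derivative, as
    lam >= k. By the maximum principle it stays bounded above, hence f t - e is
    at most of order expR (- k t). *)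
Lemma forced_decay f df lam (k : R) : 0 < k ->
  (forall t, 0 < t -> is_derive t (1 : R) f (df t)) ->
  (forall t, 0 < t -> 0 <= f t) -> (forall t, 0 < t -> k <= lam t) ->
  (forall e, 0 < e -> \forall t \near +oo, df t <= - lam t * (f t - e)) ->
  f t @[t --> +oo] --> (0 : R).
Proof.
move=> k0 fdf f0 klam Hdf; apply/cvgrPdist_le => e e0.
have e20 : 0 < e / 2 by lra.
have [t0 t0_gt0 Ht0] : exists2 t0, 0 < t0 &
    forall t, t0 <= t -> df t <= - lam t * (f t - e / 2).
  have [M [_ HM]] := Hdf _ e20; exists (Num.max (M + 1) 1).
    by rewrite lt_max ltr01 orbT.
  by move=> t; rewrite ge_max => /andP[Mt _]; apply: HM; lra.
pose F t := expR (k * t) * (f t - e / 2).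
pose dF t := expR (k * t) * (k * (f t - e / 2) + df t).
have FdF t : t0 <= t -> is_derive t (1 : R) F (dF t).
  move=> tt; have ft := fdf t (lt_le_trans t0_gt0 tt).
  have kt : is_derive t (1 : R) (fun s : R => k * s) k.
    by apply: is_derive_eq; rewrite [LHS]mulr1.
  have et := @is_derive1_comp _ expR _ _ _ _ (is_derive_expR (k * t)) kt.
  have ct := @is_deriveB _ _ _ _ _ _ _ _ _ ft (is_derive_cst (e / 2) t 1).
  have FD : is_derive t (1 : R) F _ := is_deriveM et ct.
  apply: is_derive_eq FD _.
  rewrite /dF /= subr0 /GRing.scale/= (_ : (f - cst (e / 2)) t = f t - e / 2) //.
  by ring.
pose K := Num.max (F t0) 0.
have FK t : t0 <= t -> F t <= K.
  move=> tt; apply: (@le_max_of_derive_le0 F dF) => // s t0s _; first exact: FdF.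
  rewrite /F pmulr_rgt0 ?expR_gt0// => fs.
  rewrite /dF pmulr_rle0 ?expR_gt0//.
  have := Ht0 s t0s; have := klam s (lt_le_trans t0_gt0 t0s); nra.
have K0 : 0 <= K by rewrite le_max lexx orbT.
near=> t.
have tt : t0 <= t by near: t; exact: nbhs_pinfty_ge (num_real _).
have tK : K / (e / 2) / k <= t by near: t; exact: nbhs_pinfty_ge (num_real _).
rewrite sub0r normrN ger0_norm; last by apply: f0; lra.
have := FK t tt; rewrite /F.
have := expR_ge1Dx (k * t); have := expR_gt0 (k * t).
move: tK; rewrite ler_pdivrMr// ler_pdivrMr//.
nra.
Unshelve. all: by end_near. Qed.

Lemma is_derive_bigsum (I : Type) (r : seq I) (h : I -> R -> R) (dh : I -> R) t :
  (forall i, is_derive t (1 : R) (h i) (dh i)) ->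
  is_derive t (1 : R) (fun s => \sum_(i <- r) h i s) (\sum_(i <- r) dh i).
Proof.
move=> hdh; elim: r => [|i r IHr].
  rewrite big_nil; under eq_fun do rewrite big_nil.
  exact: is_derive_cst.
rewrite big_cons; under eq_fun do rewrite big_cons.
exact: is_deriveD.
Qed.

End Calculus.

(** * Decay of the chi-square divergence along the annealing *)
Section Convergence.
Context {R : realType} {X : finType}.
Implicit Types (Q : X -> X -> R) (U pi : X -> R) (T : R -> R).

Lemma gibbs_inv U pi (tau : R) x : (forall x, 0 < pi x) -> \sum_x pi x = 1 ->
  (gibbs U pi tau x)^-1 =
  \sum_y pi y / pi x * expR ((U x - U y) * tau^-1).
Proof.
move=> pi_gt0 pi1; rewrite invf_div /gibbs_Z mulr_suml; apply: eq_bigr => y _.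
rewrite mulrBl expRD -[- (U y / tau)]mulNr.
have := gt_eqF (pi_gt0 x); have := gt_eqF (expR_gt0 (- U x / tau)) => e0 p0.
have -> : expR (U x / tau) = (expR (- U x / tau))^-1.
  by rewrite -expRN mulNr opprK.
by field; rewrite e0 p0.
Qed.

(** In terms of the inverse temperature beta, the second moment is
    sum_{x,y} (pi y / pi x) (mu x)^2 expR ((U x - U y) beta). Differentiating the
    exponentials gives factors (U x - U y) beta', which are at most Umax beta'. *)
Lemma second_moment_derive U pi (Umax : R) (mu : X -> R -> R) (dmu : X -> R)
    (beta : R -> R) (dbeta t : R) :
  (forall x, 0 < pi x) -> \sum_x pi x = 1 ->
  (forall x, 0 <= U x) -> (forall x, U x <= Umax) ->
  (forall x, is_derive t (1 : R) (mu x) (dmu x)) ->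
  is_derive t (1 : R) beta dbeta -> 0 <= dbeta ->
  exists2 dF, is_derive t (1 : R)
      (fun s => second_moment (gibbs U pi (beta s)^-1) (mu ^~ s)) dF &
    dF <= 2 * (\sum_x dmu x * (mu x t / gibbs U pi (beta t)^-1 x)) +
      Umax * dbeta * second_moment (gibbs U pi (beta t)^-1) (mu ^~ t).
Proof.
move=> pi_gt0 pi1 U_ge0 U_max mu' beta' db0.
pose w x y := pi y / pi x.
pose e x y s := expR ((U x - U y) * beta s).
have ginv x s : (gibbs U pi (beta s)^-1 x)^-1 = \sum_y w x y * e x y s.
  by rewrite gibbs_inv// invrK.
have smE : (fun s => second_moment (gibbs U pi (beta s)^-1) (mu ^~ s)) =
    (fun s => \sum_x \sum_y w x y * (mu x s ^+ 2 * e x y s)).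
  apply/funext => s; apply: eq_bigr => x _; rewrite ginv mulr_sumr.
  by apply: eq_bigr => y _; rewrite mulrCA.
pose d x y := w x y * (2 * (dmu x * mu x t) * e x y t +
   mu x t ^+ 2 * (e x y t * ((U x - U y) * dbeta))).
exists (\sum_x \sum_y d x y).
  rewrite smE; apply: is_derive_bigsum => x; apply: is_derive_bigsum => y.
  have b' : is_derive t (1 : R) (fun s => (U x - U y) * beta s) ((U x - U y) * dbeta).
    exact: is_deriveZ.
  have e' : is_derive t (1 : R) (e x y) (e x y t * ((U x - U y) * dbeta)).
    exact: (@is_derive1_comp _ expR _ _ _ _ (is_derive_expR _) b').
  have m' := is_deriveX 2 (mu' x).
  have h' : is_derive t (1 : R) (fun s => w x y * (mu x s ^+ 2 * e x y s)) _ :=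
    is_deriveZ (w x y) (is_deriveM m' e').
  apply: is_derive_eq h' _.
  rewrite /d /GRing.scale/= (_ : (mu x ^+ 2) t = mu x t ^+ 2) //; ring.
have -> : second_moment (gibbs U pi (beta t)^-1) (mu ^~ t) =
    \sum_x \sum_y w x y * (mu x t ^+ 2 * e x y t).
  by have /(congr1 (fun f => f t)) := smE.
rewrite !mulr_sumr -big_split/=; apply: ler_sum => x _.
rewrite ginv !mulr_sumr -big_split/=; apply: ler_sum => y _.
have w0 : 0 <= w x y * mu x t ^+ 2 * e x y t.
  by rewrite mulr_ge0 ?expR_ge0// mulr_ge0 ?sqr_ge0// divr_ge0// ltW.
have Ud : (U x - U y) * dbeta <= Umax * dbeta.
  by rewrite ler_wpM2r//; have := U_ge0 y; have := U_max x; lra.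
have := ler_wpM2l w0 Ud; rewrite /d; nra.
Qed.

(** Once T <= 1, T^2 + T^3 is at most 2 T^2, so that |T'| / T^2 is negligible
    with respect to expR (- c / T). *)
Lemma small_drift c T (K eta : R) : cooling_schedule T -> derivative_condition c T ->
  0 <= K -> 0 < eta ->
  \forall t \near +oo, K * (`|derive1 T t| / T t ^+ 2) <= eta * expR (- c / T t).
Proof.
move=> [T_gt0 T_dec T0] dT K0 eta0.
have d0 : 0 < eta / (2 * (K + 1)) by rewrite divr_gt0//; lra.
have T1 : \forall t \near +oo, T t <= 1.
  by apply: (cvgr_le _ T0); rewrite ltr01.
have dT1 := cvgr_le _ dT _ d0.
near=> t.
have t0 : 0 <= t by near: t; exact: nbhs_pinfty_ge (num_real _).
have Tt := T_gt0 t t0.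
have Tt1 : T t <= 1 by near: t.
have : `|derive1 T t| * (expR (c / T t) / (T t ^+ 2 + T t ^+ 3)) <=
  eta / (2 * (K + 1)) by near: t; exact: dT1.
have ec : expR (- c / T t) = (expR (c / T t))^-1 by rewrite mulNr expRN.
rewrite ec; move: (expR_gt0 (c / T t)); move: (expR _) => e e0.
move: (T t) Tt Tt1 => tau tau0 tau1; move: (`|_|) (normr_ge0 (derive1 T t)) => b b0.
have s0 : 0 < tau ^+ 2 + tau ^+ 3 by rewrite addr_gt0 ?exprn_gt0.
have q0 : 0 < tau ^+ 2 by rewrite exprn_gt0.
have q3 : tau ^+ 3 <= tau ^+ 2 by rewrite exprS; nra.
set r := eta / (2 * (K + 1)).
have rE : r * (2 * (K + 1)) = eta by rewrite /r; field; apply: lt0r_neq0; lra.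
move=> bsr; have bs : b * e <= r * (tau ^+ 2 + tau ^+ 3).
  by rewrite -ler_pdivrMr// -mulrA.
rewrite mulrA ler_pdivrMr// -mulrA [e^-1 * _]mulrC mulrA ler_pdivlMr//.
have r0 : 0 < r by [].
have : K * (b * e) <= K * (r * (tau ^+ 2 + tau ^+ 3)) by exact: ler_wpM2l.
have : K * (r * (tau ^+ 2 + tau ^+ 3)) <= K * (r * (2 * tau ^+ 2)).
  by apply: ler_wpM2l => //; apply: ler_wpM2l; [exact: ltW|lra].
nra.
Unshelve. all: by end_near. Qed.

(** The spectral gap and the bound on the drift of the Gibbs distribution give
    G' <= - 2 lam G + Umax |T'| / T^2 (G + 1) for the chi-square divergence G,
    to which forced_decay applies. *)
Lemma chi_square_cvg0 Q U pi T (P : R -> R -> X -> X -> R) x :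
  is_generator Q -> ergodic Q -> (forall x, 0 < pi x) -> \sum_x pi x = 1 ->
  reversible Q pi -> (forall x, 0 <= U x) -> (exists x, U x = 0) ->
  c_M2 Q U <= 0 -> cooling_schedule T -> differentiable_schedule T ->
  is_transition_semigroup (fun t => M2 Q U (T t)) P ->
  derivative_condition (c_M2 Q U) T ->
  second_moment (gibbs U pi (T t)) (P 0 t x) - 1 @[t --> +oo] --> (0 : R).
Proof.
move=> Q_gen Q_erg pi_gt0 pi1 Q_rev U_ge0 U_min c_le0 T_cool T_diff.
move=> [P_distr _ _ P_fwd] T_cond.
have [T_gt0 T_dec _] := T_cool.
pose c := c_M2 Q U; pose Umax := \sum_y U y.
have U_max y : U y <= Umax by rewrite /Umax (bigD1 y)//= lerDl sumr_ge0.
have Umax0 : 0 <= Umax by exact: sumr_ge0.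
have [k k0 gap] := M2_spectral_gap Q_gen Q_erg pi_gt0 pi1 Q_rev U_min.
have nbhs0 (t : R) : 0 < t -> nbhs t [set` `[(0 : R), +oo[ ].
  move=> t0; have := near_in_itvoy; move=> /(_ _ 0 t); rewrite in_itv/= t0 => /(_ isT).
  by apply: filterS => s; rewrite /= !in_itv/= !andbT => /ltW.
have T' (t : R) : 0 < t -> is_derive t (1 : R) T (derive1 T t).
  move=> t0; have [l /(is_derive_withinE (nbhs0 t t0)) Tl] := T_diff t (ltW t0).
  by rewrite derive1E derive_val.
pose db t := `|derive1 T t| / T t ^+ 2.
have beta' (t : R) : 0 < t -> is_derive t (1 : R) (fun s => (T s)^-1) (db t).
  move=> t0; have Tt := T_gt0 t (ltW t0).
  apply: is_derive_eq (is_deriveV (lt0r_neq0 Tt) (T' t t0)) _.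
  rewrite /db ler0_norm; first by rewrite [LHS]mulNr mulNr; congr (- _); exact: mulrC.
  apply: is_derive_nonincreasing_le0 (T' t t0) _ => s ts.
  exact: T_dec (ltW t0) ts.
pose lam t := k * expR (- c / T t).
pose F t := second_moment (gibbs U pi (T t)) (P 0 t x).
have F' (t : R) : 0 < t -> exists dF, is_derive t (1 : R) (fun s => F s - 1) dF /\
    dF <= - 2 * lam t * (F t - 1) + Umax * db t * F t.
  move=> t0; have Tt := T_gt0 t (ltW t0).
  have mu' y : is_derive t (1 : R) (fun s => P 0 s x y)
      (\sum_z P 0 t x z * M2 Q U (T t) z y).
    apply: is_derive_withinE (nbhs0 t t0) _.
    exact: P_fwd (lexx 0) (ltW t0).
  have [|dF] := second_moment_derive pi_gt0 pi1 U_ge0 U_max mu' (beta' t t0).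
    by rewrite divr_ge0 ?sqr_ge0.
  under eq_fun do rewrite invrK.
  rewrite invrK => FdF dF_le; exists dF; split.
    have FB : is_derive t (1 : R) (fun s => F s - 1) _ :=
      is_deriveB FdF (is_derive_cst (1 : R) t 1).
    by apply: is_derive_eq FB _; rewrite subr0.
  apply: le_trans dF_le _; rewrite lerD2r.
  have [_ P1] := P_distr 0 t x (lexx 0) (ltW t0).
  have := gap (P 0 t x) (T t) Tt P1; rewrite -/c -/(lam t) -/(F t); lra.
have /choice[dF HdF] : forall t : R, exists dF, 0 < t ->
    is_derive t (1 : R) (fun s => F s - 1) dF /\
    dF <= - 2 * lam t * (F t - 1) + Umax * db t * F t.
  move=> t; have [t0|_] := ltP 0 t; last by exists 0.
  by have [d Hd] := F' t t0; exists d.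
have F_ge1 (t : R) : 0 < t -> 0 <= F t - 1.
  move=> t0; have g0 y := gibbs_gt0 U (T t) y pi_gt0 pi1.
  have Pd := P_distr 0 t x (lexx 0) (ltW t0).
  exact: le_trans (Ent_ge0 g0 (gibbs_sum U (T t) pi_gt0 pi1) Pd) (Ent_le g0 Pd).
apply: (@forced_decay _ (fun t => F t - 1) dF lam k) => //.
- by move=> t /HdF[].
- move=> t t0; rewrite ler_peMr ?(ltW k0)// -expR0 ler_expR.
  by rewrite divr_ge0 ?oppr_ge0// ltW// T_gt0// ltW.
(* With m <= 1 and m <= e, m (G + 1) is at most G + e, so that the drift term
   lam m (G + 1) is absorbed by one of the two copies of lam G. *)
move=> e e0; pose m := Num.min e 1.
have m0 : 0 < m by rewrite lt_min e0 ltr01.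
have me : m <= e by rewrite ge_min lexx.
have m1 : m <= 1 by rewrite ge_min lexx orbT.
have drift := small_drift T_cool T_cond Umax0 (mulr_gt0 k0 m0).
near=> t.
have t0 : 0 < t by near: t; exact: nbhs_pinfty_gt (num_real _).
have drt : Umax * db t <= k * m * expR (- c / T t) by near: t.
have [_ dFt] := HdF t t0; apply: le_trans dFt _.
have G0 := F_ge1 t t0.
have lam0 : 0 < lam t by rewrite mulr_gt0 ?expR_gt0.
have {}drt : Umax * db t <= lam t * m by rewrite /lam mulrAC.
have : Umax * db t * F t <= lam t * m * F t by rewrite ler_wpM2r//; lra.
have : m * F t <= F t - 1 + e by nra.
move=> /(ler_wpM2l (ltW lam0)); nra.
Unshelve. all: by end_near. Qed.

Lemma Ent_cvg0 Q U pi T (P : R -> R -> X -> X -> R) x :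
  is_generator Q -> ergodic Q -> is_stationary Q pi ->
  reversible Q pi -> (forall x, 0 <= U x) -> (exists x, U x = 0) ->
  c_M2 Q U <= 0 -> cooling_schedule T -> differentiable_schedule T ->
  is_transition_semigroup (fun t => M2 Q U (T t)) P ->
  derivative_condition (c_M2 Q U) T ->
  Ent (gibbs U pi (T t)) (P 0 t x) @[t --> +oo] --> (0 : R).
Proof.
move=> Q_gen Q_erg pi_stat Q_rev U_ge0 U_min c_le0 T_cool T_diff P_semi T_cond.
have pi_gt0 := reversible_gt0 Q_erg (proj1 pi_stat) Q_rev.
have [[_ pi1] _] := pi_stat; have [P_distr _ _ _] := P_semi.
have chi := chi_square_cvg0 x Q_gen Q_erg pi_gt0 pi1 Q_rev U_ge0 U_min c_le0
  T_cool T_diff P_semi T_cond.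
apply: squeeze_cvgr (cvg_cst 0) chi; near=> t.
have t0 : 0 <= t by near: t; exact: nbhs_pinfty_ge (num_real _).
have g0 y := gibbs_gt0 U (T t) y pi_gt0 pi1.
have Pd := P_distr 0 t x (lexx 0) t0.
by rewrite Ent_ge0 ?Ent_le// gibbs_sum.
Unshelve. all: by end_near. Qed.

End Convergence.

(** * Examples of schedules *)
Section Schedules.
Context {R : realType}.
Implicit Types (T : R -> R) (c a t : R).

(** The integral is at least that of the constant m over [0, s], which is s m;
    so it is infinite when s m can be made arbitrarily large. *)
Lemma integral_condition_lb c T (dT : R -> R) :
  (forall t, 0 <= t -> 0 < T t) ->
  (forall t, 0 <= t -> is_derive t (1 : R) T (dT t)) ->
  (forall A : R, exists s m : R, [/\ 0 < s, 0 <= m, A <= s * m &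
     forall t, 0 <= t -> t <= s -> m <= (1 + 1 / T t)^-1 * expR (- c / T t)]) ->
  integral_condition c T.
Proof.
move=> T_gt0 T' lb; rewrite /integral_condition.
set g := fun t => (1 + 1 / T t)^-1 * expR (- c / T t).
have g0 t : 0 <= t -> 0 <= g t.
  move=> t0; rewrite mulr_ge0 ?expR_ge0// invr_ge0 addr_ge0// divr_ge0// ltW//.
  exact: T_gt0.
have mg : measurable_fun [set` `[(0 : R), +oo[ ] (EFin \o g).
  apply/measurable_EFinP.
  apply: subspace_continuous_measurable_fun => //.
  apply: derivable_within_continuous => t; rewrite in_itv/= andbT => t0.
  have Tt := T_gt0 t t0.
  have iT := is_deriveV (lt0r_neq0 Tt) (T' t t0).
  have i1 : is_derive t (1 : R) (fun t => 1 + 1 / T t) _ :=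
    is_deriveD (is_derive_cst (1 : R) t 1) (is_deriveZ 1 iT).
  have i1n : 1 + 1 / T t != 0 by rewrite lt0r_neq0// ltr_pwDl// divr_ge0// ltW.
  have i2 : is_derive t (1 : R) (fun t => (1 + 1 / T t)^-1) _ :=
    @is_deriveV _ (fun t => 1 + 1 / T t) _ _ _ i1n i1.
  have i3 : is_derive t (1 : R) (fun t => expR (- c / T t)) _ :=
    is_derive1_comp (is_derive_expR _) (is_deriveZ (- c) iT).
  by have [] := is_deriveM i2 i3.
apply/eqyP => A _; have [s [m [s0 m0 Asm mle]]] := lb A.
have -> : (fun t => ((1 + 1 / T t)^-1 * expR (- c / T t))%:E) = EFin \o g by [].
pose S := [set` `[(0 : R), s]].
have sub : S `<=` [set` `[(0 : R), +oo[ ].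
  by move=> t; rewrite /S/= !in_itv/= andbT => /andP[].
have gS := ge0_subset_integral lebesgue_measure (measurable_itv _) (measurable_itv _)
  mg _ sub.
apply: le_trans (gS _); last by move=> t /=; rewrite in_itv/= andbT => /g0.
have mS : (\int[lebesgue_measure]_(t in S) (cst m%:E) t <=
    \int[lebesgue_measure]_(t in S) (EFin \o g) t)%E.
  apply: ge0_le_integral => //.
  - exact: measurable_itv.
  - exact: measurable_funS mg.
  - by move=> t; rewrite /S/= in_itv/= => /andP[t0 ts]; rewrite /= lee_fin mle.
apply: le_trans mS; rewrite integral_cst; last exact: measurable_itv.
rewrite [X in (_ * X)%E](_ : _ = s%:E).
  by rewrite -EFinM lee_fin mulrC.
by rewrite [LHS]lebesgue_measure_itv/= lte_fin s0 sube0.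
Qed.

Lemma powR_shift_cvg0 a : 0 < a -> (t + 1) `^ (- a) @[t --> +oo] --> (0 : R).
Proof.
move=> a0; apply/cvgrPdist_le => e e0; near=> t.
have t0 : 0 <= t by near: t; exact: nbhs_pinfty_ge (num_real _).
have te : e `^ (- a^-1) <= t by near: t; exact: nbhs_pinfty_ge (num_real _).
rewrite sub0r normrN ger0_norm ?powR_ge0// powRN invf_ple ?posrE ?powR_gt0//; last lra.
apply: (@le_trans _ _ ((e `^ (- a^-1)) `^ a)).
  by rewrite -powRrM mulNr mulVf ?gt_eqF// powR_inv1// ltW.
apply: ge0_ler_powR; rewrite ?nnegrE ?powR_ge0//; lra.
Unshelve. all: by end_near. Qed.

Lemma power_schedule_gt0 a t : 0 <= t -> 0 < power_schedule a t.
Proof. by move=> t0; rewrite powR_gt0//; lra. Qed.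

Lemma power_schedule_cooling a : 0 < a -> cooling_schedule (@power_schedule R a).
Proof.
move=> a0; split; [exact: power_schedule_gt0| |exact: powR_shift_cvg0].
move=> s t s0 st; rewrite /power_schedule !powRN.
have h : (s + 1) `^ a <= (t + 1) `^ a.
  by apply: ge0_ler_powR; rewrite ?nnegrE; lra.
by rewrite lef_pV2// posrE powR_gt0//; lra.
Qed.

Lemma is_derive_power_schedule a t : 0 <= t ->
  is_derive t (1 : R) (power_schedule a) (- a * (t + 1) `^ (- a - 1)).
Proof.
move=> t0; have s' : is_derive t (1 : R) (fun s : R => s + 1) 1.
  by apply: is_derive_eq; rewrite addr0.
have p' := is_derive1_powR (- a) (ltr_wpDl t0 ltr01).
have h : is_derive t (1 : R) (power_schedule a) _ :=
  @is_derive1_comp _ (@powR R ^~ (- a)) (fun s => s + 1) _ _ _ p' s'.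
by apply: is_derive_eq h _; rewrite mulr1.
Qed.

(** On [0, s] the integrand is at least 1 / (1 + (s + 1)^a), and
    s / (1 + (s + 1)^a) is of order (s + 1)^(1 - a). *)
Lemma power_schedule_integral a c : 0 < a < 1 -> c <= 0 ->
  integral_condition c (@power_schedule R a).
Proof.
move=> /andP[a0 a1] c0.
apply: (@integral_condition_lb _ _ (fun t => - a * (t + 1) `^ (- a - 1))).
- exact: power_schedule_gt0.
- exact: is_derive_power_schedule.
move=> A; have e0 : 0 < (4 * (`|A| + 1))^-1.
  by rewrite invr_gt0; have := normr_ge0 A; lra.
have b0 : 0 < 1 - a by lra.
(* 4 comes from s >= (s + 1) / 2 and 1 + (s + 1)^a <= 2 (s + 1)^a. *)
have [s s1 sA] := pinfty_ex_ge (num_real 1) (cvgr_le _ (powR_shift_cvg0 b0) _ e0).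
have s0 : 0 < s + 1 by lra.
exists s, (1 + (s + 1) `^ a)^-1; split; first by lra.
- by rewrite invr_ge0 addr_ge0 ?powR_ge0.
- have pa1 : 1 <= (s + 1) `^ a.
    by rewrite -[leLHS](powRr0 (s + 1)); apply: ler_powR; lra.
  rewrite ler_pdivlMr; last by lra.
  have : s + 1 = (s + 1) `^ (1 - a) * (s + 1) `^ a.
    rewrite -powRD; last by rewrite (gt_eqF s0) implybT.
    by rewrite subrK powRr1// ltW.
  have A0 : 0 < 4 * (`|A| + 1) by have := normr_ge0 A; lra.
  move: sA; rewrite powRN lef_pV2 ?posrE ?powR_gt0//.
  have := ler_norm A; have := normr_ge0 A; nra.
- move=> t t0 ts; rewrite /power_schedule powRN div1r invrK.
  have h : (t + 1) `^ a <= (s + 1) `^ a.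
    by apply: ge0_ler_powR; rewrite ?nnegrE; lra.
  have e1 : 1 <= expR (- c * (t + 1) `^ a).
    by rewrite -expR0 ler_expR mulr_ge0 ?powR_ge0// oppr_ge0.
  have p0 := powR_ge0 (t + 1) a.
  apply: (@le_trans _ _ (1 + (t + 1) `^ a)^-1).
    by rewrite lef_pV2 ?posrE; lra.
  by rewrite ler_peMr// invr_ge0; lra.
Qed.

(** |T'| / T^2 is a (t + 1)^(a - 1), and expR (c / T) <= 1. *)
Lemma power_schedule_derivative a c : 0 < a < 1 -> c <= 0 ->
  derivative_condition c (@power_schedule R a).
Proof.
move=> /andP[a0 a1] c0; have b0 : 0 < 1 - a by lra.
apply: squeeze_cvgr (cvg_cst 0) (powR_shift_cvg0 b0); near=> t.
have t0 : 0 <= t by near: t; exact: nbhs_pinfty_ge (num_real _).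
have T' := is_derive_power_schedule a t0.
have t1 : 0 < t + 1 by lra.
have Tt := power_schedule_gt0 a t0.
rewrite derive1E derive_val; apply/andP; split.
  rewrite mulr_ge0// divr_ge0 ?expR_ge0// addr_ge0// exprn_ge0// ltW//.
have e1 : expR (c / power_schedule a t) <= 1.
  by rewrite -expR0 ler_expR mulr_le0_ge0// invr_ge0 ltW.
rewrite mulNr normrN normrM (gtr0_norm a0) ger0_norm ?powR_ge0//.
have q0 : 0 < power_schedule a t ^+ 2 by rewrite exprn_gt0.
have q3 : 0 < power_schedule a t ^+ 3 by rewrite exprn_gt0.
rewrite mulrA ler_pdivrMr; last by rewrite addr_gt0.
have -> : (t + 1) `^ (- a - 1) = (t + 1) `^ (- (1 - a)) * power_schedule a t ^+ 2.
  rewrite expr2 /power_schedule -!powRD; try by rewrite (gt_eqF t1) implybT.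
  by congr (_ `^ _); ring.
have := powR_gt0 (- (1 - a)) t1; move: (_ `^ _) => p p0.
move: (power_schedule _ _ ^+ 2) (power_schedule _ _ ^+ 3) q0 q3 => u v u0 v0.
have pu : 0 < p * u by rewrite mulr_gt0.
have : a * (p * u) * expR (c / power_schedule a t) <= p * u.
  rewrite -mulrA mulrCA ler_piMr ?(ltW pu)//.
  by rewrite mulr_ile1 ?expR_ge0// ltW.
nra.
Unshelve. all: by end_near. Qed.

Lemma power_schedule_admissible a c : 0 < a < 1 -> c <= 0 ->
  admissible c (@power_schedule R a).
Proof.
move=> a01 c0; split.
- by apply: power_schedule_cooling; case/andP: a01.
- move=> t t0; exists (- a * (t + 1) `^ (- a - 1)).
  exact/is_derive_within_weaken/is_derive_power_schedule.
- exact: power_schedule_integral.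
- exact: power_schedule_derivative.
Qed.

(** ln (t + 1) is at most (2 / a) (t + 1)^(a / 2), as ln r <= r - 1. *)
Lemma power_schedule_ln a : 0 < a ->
  power_schedule a t * ln (t + 1) @[t --> +oo] --> (0 : R).
Proof.
move=> a0; have a20 : 0 < a / 2 by lra.
have lim : (t + 1) `^ (- (a / 2)) * (2 / a) @[t --> +oo] --> (0 : R).
  rewrite -[X in _ --> X](mul0r (2 / a)).
  exact: cvgM (powR_shift_cvg0 a20) (cvg_cst _).
apply: squeeze_cvgr (cvg_cst 0) lim; near=> t.
have t0 : 0 <= t by near: t; exact: nbhs_pinfty_ge (num_real _).
have t1 : 0 < t + 1 by lra.
have Tt := power_schedule_gt0 a t0.
rewrite mulr_ge0 ?(ltW Tt) ?ln_ge0//=; last lra.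
have -> : power_schedule a t = (t + 1) `^ (- (a / 2)) * (t + 1) `^ (- (a / 2)).
  rewrite -powRD ?(gt_eqF t1) ?implybT//; congr (_ `^ _); lra.
rewrite -mulrA ler_wpM2l ?powR_ge0// powRN.
have p0 : 0 < (t + 1) `^ (a / 2) by exact: powR_gt0.
rewrite mulrC ler_pdivrMr//.
have := @le_ln1Dx R ((t + 1) `^ (a / 2) - 1).
rewrite [1 + _]addrC subrK ln_powR => /(_ ltac:(lra)) lnle.
have -> : ln (t + 1) = 2 / a * (a / 2 * ln (t + 1)) by field; rewrite gt_eqF.
by rewrite ler_wpM2l ?divr_ge0 ?(ltW a0)//; lra.
Unshelve. all: by end_near. Qed.

(** exp (- t) <= (t + 1)^(-1) reduces this to a power schedule. *)
Lemma exp_schedule_ln : exp_schedule t * ln (t + 1) @[t --> +oo] --> (0 : R).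
Proof.
apply: squeeze_cvgr (cvg_cst 0) (power_schedule_ln ltr01); near=> t.
have t0 : 0 <= t by near: t; exact: nbhs_pinfty_ge (num_real _).
have l0 : 0 <= ln (t + 1) by rewrite ln_ge0; lra.
rewrite mulr_ge0 ?expR_ge0//= ler_wpM2r// /exp_schedule /power_schedule.
rewrite powRN powRr1; last lra.
rewrite expRN lef_pV2 ?posrE ?expR_gt0//; last lra.
by rewrite addrC expR_ge1Dx.
Unshelve. all: by end_near. Qed.

Lemma is_derive_exp_schedule t : is_derive t (1 : R) exp_schedule (- expR (- t)).
Proof.
have n' : is_derive t (1 : R) (fun s : R => - s) (- 1) by exact: is_deriveN.
have h : is_derive t (1 : R) exp_schedule _ := is_derive1_comp (is_derive_expR _) n'.
by apply: is_derive_eq h _; rewrite mulrN1.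
Qed.

(** With x = exp t, the integrand expR (- c x) / (1 + x) is at least
    (1 - c x) / (1 + x), hence at least min (1, - c). *)
Lemma exp_schedule_integral c : c < 0 -> integral_condition c (@exp_schedule R).
Proof.
move=> c0; apply: (@integral_condition_lb _ _ (fun t => - expR (- t))).
- by move=> t _; exact: expR_gt0.
- by move=> t _; exact: is_derive_exp_schedule.
move=> A; pose m := Num.min 1 (- c).
have m0 : 0 < m by rewrite lt_min ltr01 oppr_gt0.
have m1 : m <= 1 by rewrite ge_min lexx.
have mc : m <= - c by rewrite ge_min lexx orbT.
exists ((`|A| + 1) / m), m; split; rewrite ?(ltW m0)//.
- by rewrite divr_gt0// ltr_wpDl.
- by rewrite divfK ?gt_eqF//; have := ler_norm A; lra.
move=> t _ _; rewrite /exp_schedule expRN div1r invrK.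
have E0 := expR_gt0 t; have := expR_ge1Dx (- c * expR t).
rewrite [_^-1 * _]mulrC ler_pdivlMr; last lra.
nra.
Qed.

(** With x = exp t, the quantity is at most x expR (c x). Since
    expR (- c x / 2) >= 1 - c x / 2, it is at most 4 / (c^2 x). *)
Lemma exp_schedule_derivative c : c < 0 -> derivative_condition c (@exp_schedule R).
Proof.
move=> c0.
have lim : expR (- t) * (4 / c ^+ 2) @[t --> +oo] --> (0 : R).
  rewrite -[X in _ --> X](mul0r (4 / c ^+ 2)).
  exact: cvgM (@cvgr_expR R) (cvg_cst _).
apply: squeeze_cvgr (cvg_cst 0) lim; near=> t.
have T' := is_derive_exp_schedule t.
rewrite derive1E derive_val normrN ger0_norm ?expR_ge0//.
rewrite /exp_schedule expRN invrK; have := expR_gt0 t; move: (expR t) => x x0.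
have i0 : 0 < x^-1 by rewrite invr_gt0.
apply/andP; split.
  by rewrite mulr_ge0 ?(ltW i0)// divr_ge0 ?expR_ge0// addr_ge0// exprn_ge0// ltW.
have -> : expR (c * x) = (expR (- c * x / 2) ^+ 2)^-1.
  by rewrite -expRM_natl -expRN; congr expR; field.
have := expR_ge1Dx (- c * x / 2); move: (expR (- c * x / 2)) => y.
have cx : 0 < - c * x by rewrite mulr_gt0// oppr_gt0.
move=> y1; have y0 : 0 < y by lra.
have -> : x^-1 * (y ^- 2 / (x^-1 ^+ 2 + x^-1 ^+ 3)) = x ^+ 2 / (y ^+ 2 * (x + 1)).
  by field; rewrite !gt_eqF//; lra.
have -> : x^-1 * (4 / c ^+ 2) = 4 / (c ^+ 2 * x) by field; rewrite gt_eqF ?lt_eqF.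
have y2 : 0 < y ^+ 2 by rewrite exprn_gt0.
have c2 : 0 < c ^+ 2 by rewrite exprn_even_gt0//= lt_eqF.
rewrite ler_pdivrMr; last by rewrite mulr_gt0//; lra.
rewrite mulrAC ler_pdivlMr; last by rewrite mulr_gt0.
have : (c * x) ^+ 2 <= 4 * y ^+ 2 by nra.
nra.
Unshelve. all: by end_near. Qed.

Lemma exp_schedule_admissible c : c < 0 -> admissible c (@exp_schedule R).
Proof.
move=> c0; split.
- split; [by move=> t _; exact: expR_gt0| |exact: cvgr_expR].
  by move=> s t _ st; rewrite ler_expR lerN2.
- move=> t t0; exists (- expR (- t)).
  exact/is_derive_within_weaken/is_derive_exp_schedule.
- exact: exp_schedule_integral.
- exact: exp_schedule_derivative.
Qed.

End Schedules.

(** * The convergence theorem *)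

Theorem theorem3p3 (R : realType) (X : finType) (U : X -> R)
    (Q : X -> X -> R) (pi : X -> R)
    (X_ge2 : (1 < #|X|)%N)
    (U_ge0 : forall x, 0 <= U x)
    (U_min : exists x, U x = 0)
    (Q_gen : is_generator Q)
    (Q_erg : ergodic Q)
    (pi_stat : is_stationary Q pi)
    (Q_rev : reversible Q pi)
    (c_le0 : c_M2 Q U <= 0) :
  [/\ forall (T : R -> R) (P : R -> R -> X -> X -> R),
        cooling_schedule T -> differentiable_schedule T ->
        is_transition_semigroup (fun t => M2 Q U (T t)) P ->
        integral_condition (c_M2 Q U) T ->
        derivative_condition (c_M2 Q U) T ->
        forall x, Ent (gibbs U pi (T t)) (P 0 t x) @[t --> +oo] --> (0 : R),
      c_M2 Q U = 0 ->
        forall alpha : R, 0 < alpha < 1 ->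
          admissible (c_M2 Q U) (power_schedule alpha),
      c_M2 Q U < 0 ->
        (forall alpha : R, 0 < alpha < 1 ->
           admissible (c_M2 Q U) (power_schedule alpha)) /\
        admissible (c_M2 Q U) exp_schedule
    & (forall alpha : R, 0 < alpha < 1 ->
         power_schedule alpha t * ln (t + 1) @[t --> +oo] --> (0 : R)) /\
      exp_schedule t * ln (t + 1) @[t --> +oo] --> (0 : R)].
Proof.
split.
- move=> T P T_cool T_diff P_semi _ T_cond x.
  exact: (Ent_cvg0 x Q_gen Q_erg pi_stat Q_rev U_ge0 U_min c_le0).
- by move=> _ alpha alpha01; exact: power_schedule_admissible.
- move=> c_lt0; split; last exact: exp_schedule_admissible.
  by move=> alpha alpha01; exact: power_schedule_admissible.
- split; last exact: exp_schedule_ln.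
  by move=> alpha /andP[alpha0 _]; exact: power_schedule_ln.
Qed.
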